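(* Let $H$ be a complex Hilbert space, and let $\{f_k\}_{k=1}^\infty$ and $\{g_k\}_{k=1}^\infty$ be frames for $H$ such that the cross-Gram matrix $\{\langle f_k,g_j\rangle\}_{j,k=1}^\infty$ associated to these sequences is bounded and invertible as an operator on $\ell^2(\mathbb{N})$. Then $\{f_k\}_{k=1}^\infty$ and $\{g_k\}_{k=1}^\infty$ are Riesz bases for $H$.
   Context: Inner products are linear in the first argument. A sequence $\{f_k\}_{k=1}^\infty\subset H$ is a frame for $H$ if there are constants $A,B>0$ with $A\|f\|^2\le\sum_{k=1}^\infty|\langle f,f_k\rangle|^2\le B\|f\|^2$ for all $f\in H$. A Riesz basis for $H$ is a family of the form $\{Ue_k\}_{k=1}^\infty$, where $\{e_k\}_{k=1}^\infty$ is an orthonormal basis for $H$ and $U:H\to H$ is a bounded bijective linear operator. The cross-Gram matrix has $(j,k)$ entry $\langle f_k,g_j\rangle$ and defines the operator $\{c_k\}_{k=1}^\infty\mapsto\left\{\sum_{k=1}^\infty c_k\langle f_k,g_j\rangle\right\}_{j=1}^\infty$ on $\ell^2(\mathbb{N})$. Invertible means bijective with bounded inverse. *)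

(* Defs.v *)
From HB Require Import structures.
From mathcomp Require Import all_boot all_order all_algebra.
From mathcomp Require Import sesquilinear complex.
From mathcomp Require Import all_classical all_reals all_analysis.
Set Implicit Arguments.
Unset Strict Implicit.
Unset Printing Implicit Defensive.
Import Order.TTheory GRing.Theory Num.Theory Num.Def.
Import numFieldNormedType.Exports.
Local Open Scope complex_scope.
Local Open Scope classical_set_scope.
Local Open Scope ring_scope.

(* The norm of a normed space over R[i] is R[i]-valued; [rnorm] is the same
   number seen in R. *)
Definition rnorm (R : realType) (V : normedModType R[i]) (x : V) : R :=
  complex.Re `|x|.

Section Sequences.
Variable R : realType.
Local Notation C := R[i].

Definition sum_sqr_norm (c : nat -> C) : \bar R :=
  (\sum_(0 <= k <oo) ((rnorm (c k : C^o)) ^+ 2)%:E)%E.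

Definition l2 : set (nat -> C) := [set c | (sum_sqr_norm c < +oo)%E].

(* Meaningful for [c] in [l2] only: [fine] sends +oo to 0. *)
Definition l2norm (c : nat -> C) : R := Num.sqrt (fine (sum_sqr_norm c)).

Definition l2_bounded (T : (nat -> C) -> nat -> C) : Prop :=
  (forall c, l2 c -> l2 (T c)) /\
  exists K : R, forall c, l2 c -> l2norm (T c) <= K * l2norm c.

(* [C^o] is C carrying the topology and normed-space structure of its modulus. *)
Definition mx_row_series (M : nat -> nat -> C) (c : nat -> C) (j : nat) :
    nat -> C^o :=
  series (fun k => c k * M j k : C^o).

Definition mx_op (M : nat -> nat -> C) (c : nat -> C) : nat -> C :=
  fun j => limn (mx_row_series M c j).

Definition l2_bounded_mx (M : nat -> nat -> C) : Prop :=
  (forall c, l2 c -> forall j, cvgn (mx_row_series M c j)) /\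
  l2_bounded (mx_op M).

Definition l2_invertible (T : (nat -> C) -> nat -> C) : Prop :=
  set_bij l2 l2 T /\
  exists S : (nat -> C) -> nat -> C,
    l2_bounded S /\ {in l2, cancel T S}.

End Sequences.

(* [{dot H for conjC}] is linear in the first argument and does not mention the
   norm of H; H is a Hilbert space for [dot] under the additional hypothesis
   [forall x, dot x x = `|x| ^+ 2]. *)
Section Hilbert.
Variables (R : realType) (H : completeNormedModType R[i]).
Variable dot : {dot H for conjC}.

Definition cross_gram (f g : nat -> H) : nat -> nat -> R[i] :=
  fun j k => dot (f k) (g j).

Definition frame (f : nat -> H) : Prop :=
  exists A B : R, 0 < A /\ 0 < B /\
    forall x : H,
      ((A * rnorm x ^+ 2)%:E <= sum_sqr_norm (fun k => dot x (f k)) /\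
       sum_sqr_norm (fun k => dot x (f k)) <= (B * rnorm x ^+ 2)%:E)%E.

(* Schauder basis: unique, possibly conditionally convergent, expansions. *)
Definition basis (e : nat -> H) : Prop :=
  forall x : H, exists! c : nat -> R[i], series (fun k => c k *: e k) @ \oo --> x.

Definition orthonormal_basis (e : nat -> H) : Prop :=
  (forall j k, dot (e j) (e k) = (j == k)%:R) /\ basis e.

Definition bounded_operator (U : H -> H) : Prop :=
  exists K : R, forall x, rnorm (U x) <= K * rnorm x.

Definition riesz_basis (f : nat -> H) : Prop :=
  exists (e : nat -> H) (U : {linear H -> H}),
    orthonormal_basis e /\ bounded_operator U /\ bijective U /\
    forall k, f k = U (e k).

End Hilbert.

(* Main.v *)
Require Import Defs.
From HB Require Import structures.
From mathcomp Require Import all_boot all_order all_algebra.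
From mathcomp Require Import sesquilinear complex.
From mathcomp Require Import all_classical all_reals all_analysis.
From mathcomp Require Import ring lra.
Set Implicit Arguments.
Unset Strict Implicit.
Unset Printing Implicit Defensive.
Import Order.TTheory GRing.Theory Num.Theory.
Import numFieldNormedType.Exports.
Local Open Scope complex_scope.
Local Open Scope classical_set_scope.
Local Open Scope ring_scope.

(* With T_f : c |-> sum_k c_k f_k the synthesis operator and C_g : x |-> (<x, g_j>)_j
   the analysis operator, the cross-Gram matrix is C_g T_f. Its bijectivity makes
   T_f injective and C_g surjective, C_g is injective by the lower frame bound, and
   therefore T_f is a bijection l^2 -> H. Choose h_k with C_g h_k = delta_k. The
   lower bound of g makes h a Bessel sequence, orthogonality to h forces 0, and
   y = sum_k <y, h_k> g_k, so T_g is bijective too. Gram-Schmidt applied to g, whose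
   residuals r_n do not vanish because <r_n, h_n> = 1, yields an orthonormal basis e,
   and x |-> T_f (<x, e_k>)_k is the operator sending e_k to f_k. *)

(** * The norm as a real number *)

Section RealNorm.
Variables (R : realType) (V : normedModType R[i]).
Implicit Types (x y : V) (u : nat -> V).

Lemma rnormE x : (rnorm x)%:C = `|x|.
Proof. exact/RRe_real/ger0_real. Qed.

Lemma rnorm_ge0 x : 0 <= rnorm x.
Proof. by rewrite -ler0c rnormE. Qed.

Lemma rnorm_eq0 x : rnorm x = 0 -> x = 0.
Proof. by move=> x0; apply/normr0_eq0; rewrite -rnormE x0. Qed.

Lemma rnorm_le_add x y : rnorm (x + y) <= rnorm x + rnorm y.
Proof. by rewrite -lecR rmorphD /= !rnormE ler_normD. Qed.

(** Positive elements of [R[i]] are real, so testing with real radii loses nothing. *)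
Lemma rnorm_cvgP u x : (u @ \oo --> x) <->
  forall e : R, 0 < e -> exists N, forall n, (N <= n)%N -> rnorm (x - u n) < e.
Proof.
split=> [/cvgrPdist_lt ux e e0|ux].
  have [|N _ uN] := ux e%:C; first by rewrite ltcR.
  by exists N => n /uN /=; rewrite -rnormE ltcR.
apply/cvgrPdist_lt => e e0; have eE : e = (complex.Re e)%:C.
  by rewrite RRe_real // gtr0_real.
have [|N uN] := ux (complex.Re e); first by rewrite -ltcR -eE.
by exists N => // n /= /uN; rewrite -rnormE eE ltcR.
Qed.

End RealNorm.

(** * Square-summable sequences through their partial sums *)

Section SquareSummable.
Variable R : realType.
Local Notation C := R[i].
Implicit Types (z w : C) (c : nat -> C) (B : R).

Definition sqmod z : R := rnorm (z : C^o) ^+ 2.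

Lemma sqmod_ge0 z : 0 <= sqmod z.
Proof. exact: sqr_ge0. Qed.

Lemma sqmodE z : (sqmod z)%:C = z * z^*.
Proof. by rewrite rmorphXn /= rnormE normCK. Qed.

Lemma sqmodReIm z : sqmod z = complex.Re z ^+ 2 + complex.Im z ^+ 2.
Proof. by apply: complexI; rewrite add_Re2_Im2 rmorphXn /= rnormE. Qed.

Lemma sqmod0 : sqmod 0 = 0.
Proof. by rewrite sqmodReIm /= expr0n addr0. Qed.

(** With [z = a + ib] and [w = c + id], this expands [(B a - c)^2 + (B b + d)^2 >= 0]. *)
Lemma Re_mul_le B z w :
  2 * B * complex.Re (z * w) <= B ^+ 2 * sqmod z + sqmod w.
Proof.
rewrite !sqmodReIm; case: z w => [a b] [c d] /=.
have := sqr_ge0 (B * a - c); have := sqr_ge0 (B * b + d); lra.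
Qed.

Definition sqsum c n : R := \sum_(0 <= k < n) sqmod (c k).

Lemma sqsumS c n : sqsum c n.+1 = sqsum c n + sqmod (c n).
Proof. exact: big_nat_recr. Qed.

Lemma sqsum_homo c : {homo sqsum c : m n / (m <= n)%N >-> m <= n}.
Proof.
by apply: (nondecreasing_seqP _).1 => n; rewrite sqsumS lerDl sqmod_ge0.
Qed.

Lemma sum_sqr_norm_leP c B :
  (sum_sqr_norm c <= B%:E)%E <-> forall n, sqsum c n <= B.
Proof.
have c0 k : (0 <= (sqmod (c k))%:E)%E by rewrite lee_fin sqmod_ge0.
split=> [cB n|cB].
  rewrite -lee_fin; apply: le_trans cB; rewrite /sqsum -sumEFin.
  by apply: nneseries_lim_ge => k _ _; exact: c0.
apply: lime_le; first by apply: is_cvg_nneseries => k _ _; exact: c0.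
by apply: nearW => n /=; rewrite sumEFin lee_fin cB.
Qed.

Lemma l2P c : l2 c <-> exists B, forall n, sqsum c n <= B.
Proof.
rewrite /l2 /=; split=> [|[B /sum_sqr_norm_leP cB]]; last first.
  by apply: le_lt_trans cB _; rewrite ltry.
have : (0 <= sum_sqr_norm c)%E.
  by apply: nneseries_ge0 => k _ _; rewrite lee_fin sqr_ge0.
case E : (sum_sqr_norm c) => [B| |] // _ _; exists B.
by apply/sum_sqr_norm_leP; rewrite E.
Qed.

Lemma l2_tail c : l2 c -> forall e : R, 0 < e ->
  exists N, forall m n, (N <= m <= n)%N -> sqsum c n - sqsum c m < e.
Proof.
move=> /l2P[B cB] e e0.
have hub : has_ubound (range (sqsum c)) by exists B => _ [n _ <-].
have := nondecreasing_cvgn (@sqsum_homo c) hub; set s := sup _.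
move=> /cvgrPdist_lt /(_ e e0)[N _ cN].
(* The limit [s] dominates [sqsum c n], so closeness of [sqsum c m] to [s] alone controls the
   block. *)
have hs n : sqsum c n <= s by apply: ub_le_sup => //; exists n.
exists N => m n /andP[Nm mn].
by have := cN m Nm; rewrite /= ger0_norm ?subr_ge0 //; have := hs n; lra.
Qed.

End SquareSummable.

(** * Inner product identities and Cauchy-Schwarz *)

Section Synthesis.
Variables (R : realType) (H : completeNormedModType R[i]).
Variable dot : {dot H for Num.conj}.
Hypothesis normE : forall x : H, dot x x = `|x| ^+ 2.
Implicit Types (x y : H) (e f g h u : nat -> H) (c d : nat -> R[i]) (B : R).

Lemma dotC x y : dot x y = (dot y x)^*.
Proof. by rewrite hermC expr0 mul1r. Qed.

Lemma dotDl x y z : dot (x + y) z = dot x z + dot y z.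
Proof. exact: linearDl. Qed.

Lemma dotBl x y z : dot (x - y) z = dot x z - dot y z.
Proof. exact: linearBl. Qed.

Lemma dotZl a x z : dot (a *: x) z = a * dot x z.
Proof. exact: linearZl_LR. Qed.

Lemma dotZr a x z : dot x (a *: z) = a^* * dot x z.
Proof. exact: linearZr_LR. Qed.

Lemma dot0l z : dot 0 z = 0.
Proof. exact: linear0l. Qed.

Lemma dot_suml (F : nat -> H) m n z :
  dot (\sum_(m <= k < n) F k) z = \sum_(m <= k < n) dot (F k) z.
Proof. exact: (big_morph (dot^~ z) (fun x y => dotDl x y z) (dot0l z)). Qed.

Lemma dotxx x : dot x x = (rnorm x ^+ 2)%:C.
Proof. by rewrite normE rmorphXn /= rnormE. Qed.

Lemma sqmod_dotC x y : sqmod (dot x y) = sqmod (dot y x).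
Proof. by apply: complexI; rewrite !sqmodE dotC conjCK mulrC. Qed.

Lemma rnormB_sqr x y :
  rnorm (x - y) ^+ 2 = rnorm x ^+ 2 + rnorm y ^+ 2 - 2 * complex.Re (dot x y).
Proof.
apply: complexI; rewrite -dotxx dnormB !dotxx addcJ.
by rewrite rmorphB rmorphD [X in _ = _ - X]rmorphM rmorph_nat.
Qed.

Lemma rnormZ_sqr a x : rnorm (a *: x) ^+ 2 = sqmod a * rnorm x ^+ 2.
Proof. by apply: complexI; rewrite -dotxx dnormZ dotxx normCK -sqmodE [RHS]rmorphM. Qed.

Lemma sqmod_real (t : R) : sqmod t%:C = t ^+ 2.
Proof. by rewrite sqmodReIm /= expr0n addr0. Qed.

Lemma Re_realM (t : R) (z : R[i]) : complex.Re (t%:C * z) = t * complex.Re z.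
Proof. by case: z => a b /=; rewrite mul0r subr0. Qed.

Lemma Re_sum (F : nat -> R[i]) m n :
  complex.Re (\sum_(m <= k < n) F k) = \sum_(m <= k < n) complex.Re (F k).
Proof. by apply: (big_morph (@complex.Re R)) => [[a b] [c d]|]. Qed.

Lemma Re_dot_le B x y :
  2 * B * complex.Re (dot x y) <= B ^+ 2 * rnorm x ^+ 2 + rnorm y ^+ 2.
Proof.
have := sqr_ge0 (rnorm (B%:C *: x - y)).
rewrite rnormB_sqr rnormZ_sqr sqmod_real dotZl Re_realM; lra.
Qed.

Lemma dot_Cauchy_Schwarz x y : sqmod (dot x y) <= rnorm x ^+ 2 * rnorm y ^+ 2.
Proof.
have [->|y0] := eqVneq y 0.
  by rewrite dotC dot0l conjC0 sqmod0 mulr_ge0 ?sqr_ge0.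
have Y0 : 0 < rnorm y ^+ 2 by rewrite -ltcR -dotxx dnorm_gt0.
(* This vector is the component of [x] orthogonal to [y], scaled by [|y|^2] to avoid a division. *)
have := sqr_ge0 (rnorm ((rnorm y ^+ 2)%:C *: x - dot x y *: y)).
rewrite rnormB_sqr !rnormZ_sqr sqmod_real dotZl dotZr Re_realM.
rewrite [(dot x y)^* * _]mulrC -sqmodE /=.
have -> : (rnorm y ^+ 2) ^+ 2 * rnorm x ^+ 2 + sqmod (dot x y) * rnorm y ^+ 2
   - 2 * (rnorm y ^+ 2 * sqmod (dot x y)) =
   rnorm y ^+ 2 * (rnorm x ^+ 2 * rnorm y ^+ 2 - sqmod (dot x y)) by ring.
by rewrite pmulr_rge0 // subr_ge0.
Qed.

Lemma dot_cvg u x y :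
  u @ \oo --> x -> (fun n => dot (u n) y : R[i]^o) @ \oo --> (dot x y : R[i]^o).
Proof.
move=> /rnorm_cvgP ux; apply/rnorm_cvgP => e e0.
(* Adding 1 keeps the divisor positive when [y = 0]. *)
have y1 : 0 < rnorm y + 1 by rewrite ltr_wpDl ?rnorm_ge0.
have [|N uN] := ux (e / (rnorm y + 1)); first exact: divr_gt0.
exists N => n /uN; rewrite ltr_pdivlMr //; apply: le_lt_trans.
rewrite -dotBl -(@ler_pXn2r _ 2) ?nnegrE ?mulr_ge0 ?addr_ge0 ?rnorm_ge0 //.
apply: le_trans (dot_Cauchy_Schwarz _ _) _; rewrite exprMn ler_wpM2l ?sqr_ge0 //.
by rewrite ler_pXn2r ?nnegrE ?addr_ge0 ?rnorm_ge0 // lerDl.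
Qed.

(** * Synthesis operators and Bessel sequences *)

Definition synth c f n : H := series (fun k => c k *: f k) n.

Lemma dot_synth c f n y : dot (synth c f n) y = \sum_(0 <= k < n) c k * dot (f k) y.
Proof. by rewrite /synth /series /= dot_suml; apply: eq_bigr => k _; rewrite dotZl. Qed.

Definition bessel B f : Prop :=
  forall x n, sqsum (fun k => dot x (f k)) n <= B * rnorm x ^+ 2.

(* The weighted AM-GM inequality [Re_mul_le], summed over [k], replaces the
   Cauchy-Schwarz inequality for finite sums. *)
Lemma bessel_sum_le B f c m n : 0 < B -> bessel B f ->
  rnorm (\sum_(m <= k < n) c k *: f k) ^+ 2 <= B * \sum_(m <= k < n) sqmod (c k).
Proof.
move=> B0 fB; have [nm|mn] := leqP n m.
  by rewrite !big_geq // mulr0 -lecR -dotxx dot0l.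
set y := \sum_(m <= k < n) _.
have yE : rnorm y ^+ 2 = \sum_(m <= k < n) complex.Re (c k * dot (f k) y).
  have -> : rnorm y ^+ 2 = complex.Re (dot y y) by rewrite dotxx.
  rewrite {1}/y dot_suml Re_sum; apply: eq_bigr => k _; congr complex.Re.
  exact: dotZl.
have : 2 * B * rnorm y ^+ 2 <=
    \sum_(m <= k < n) (B ^+ 2 * sqmod (c k) + sqmod (dot y (f k))).
  rewrite yE mulr_sumr; apply: ler_sum => k _; rewrite sqmod_dotC.
  exact: Re_mul_le.
rewrite big_split /= -mulr_sumr.
have : \sum_(m <= k < n) sqmod (dot y (f k)) <= B * rnorm y ^+ 2.
  apply: le_trans (fB y n); rewrite /sqsum (@big_cat_nat _ _ _ m 0%N n) //=; last exact: ltnW.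
  by rewrite lerDr sumr_ge0 // => k _; exact: sqmod_ge0.
set S := \sum_(m <= k < n) sqmod (c k) => h1 h2.
rewrite -(ler_pM2l B0); lra.
Qed.

Lemma sqsumB c m n : (m <= n)%N ->
  sqsum c n - sqsum c m = \sum_(m <= k < n) sqmod (c k).
Proof.
by move=> mn; rewrite /sqsum (big_cat_nat (leq0n m) mn) /= addrAC subrr add0r.
Qed.

Lemma synth_le B f c n : 0 < B -> bessel B f ->
  rnorm (synth c f n) ^+ 2 <= B * sqsum c n.
Proof. by move=> B0 fB; exact: bessel_sum_le. Qed.

Lemma synth_cvg B f c : 0 < B -> bessel B f -> l2 c -> cvgn (synth c f).
Proof.
move=> B0 fB c2; apply: cauchy_cvg; apply/cauchy_seriesP => e e0.
have eE : e = (complex.Re e)%:C by rewrite RRe_real // gtr0_real.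
have re0 : 0 < complex.Re e by rewrite -ltcR -eE.
(* A block of the series has squared norm at most [B] times the block of [sqsum c], whence the
   threshold [e^2 / B]. *)
have [|N cN] := l2_tail c2 (e := complex.Re e ^+ 2 / B).
  by rewrite divr_gt0 // exprn_gt0.
exists ([set m | (N <= m)%N], [set n | (N <= n)%N]); first by split; exists N.
move=> [m n] [/= Nm Nn]; rewrite -rnormE eE ltcR.
have [nm|mn] := leqP n m.
  by rewrite big_geq // -ltcR rnormE normr0 -eE.
rewrite -(@ltr_pXn2r _ 2) ?nnegrE ?rnorm_ge0 // ?ltW //.
apply: le_lt_trans (bessel_sum_le _ _ _ B0 fB) _.
rewrite mulrC -ltr_pdivlMr // -sqsumB 1?ltnW //.
by apply: cN; rewrite Nm ltnW.
Qed.

Lemma cvg_rnorm_le u x (r : R) :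
  u @ \oo --> x -> (forall n, rnorm (u n) <= r) -> rnorm x <= r.
Proof.
move=> /rnorm_cvgP ux ur; apply/ler_addgt0Pr => e /ux[N /(_ N (leqnn N)) uN].
rewrite -(subrK (u N) x) (le_trans (rnorm_le_add _ _)) // addrC.
by rewrite lerD // ltW.
Qed.

Lemma synth_lim_le B f c x (M : R) : 0 < B -> bessel B f ->
  synth c f @ \oo --> x -> (forall n, sqsum c n <= M) -> rnorm x ^+ 2 <= B * M.
Proof.
move=> B0 fB cx cM.
have M0 : 0 <= B * M.
  apply: mulr_ge0; first exact: ltW.
  by apply: le_trans (cM 0%N); rewrite /sqsum big_geq.
rewrite -(sqr_sqrtr M0) ler_pXn2r ?nnegrE ?rnorm_ge0 ?sqrtr_ge0 //.
apply: cvg_rnorm_le cx _ => n.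
rewrite -(@ler_pXn2r _ 2) ?nnegrE ?rnorm_ge0 ?sqrtr_ge0 // sqr_sqrtr //.
by apply: le_trans (synth_le _ _ B0 fB) _; rewrite ler_wpM2l // ltW.
Qed.

Lemma sum_delta c (j n : nat) :
  \sum_(0 <= k < n) c k * (k == j)%:R = if (j < n)%N then c j else 0.
Proof.
elim: n => [|n IH]; first by rewrite big_geq.
rewrite big_nat_recr //= IH ltnS; have [jn|nj|->] := ltngtP j n.
- by rewrite mulr0 addr0.
- by rewrite mulr0 addr0.
- by rewrite mulr1 add0r.
Qed.

Lemma dot_synth_biorth f y c (j n : nat) : (forall k, dot (f k) y = (k == j)%:R) ->
  dot (synth c f n) y = if (j < n)%N then c j else 0.
Proof.
move=> fy; rewrite dot_synth -sum_delta.
by apply: eq_bigr => k _; rewrite fy.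
Qed.

(** Pairing with [y] is continuous and equals [c j] on every partial sum past index [j]. *)
Lemma biorth_coef f y c x (j : nat) : (forall k, dot (f k) y = (k == j)%:R) ->
  synth c f @ \oo --> x -> dot x y = c j.
Proof.
move=> fy cx; have := @dot_cvg _ x y cx.
move/cvg_unique; apply; first exact: norm_hausdorff.
apply: cvg_near_cst; exists j.+1 => // n /= jn.
by rewrite (dot_synth_biorth _ _ fy) jn.
Qed.

(** A converse to [synth_le], by duality: for the coefficients [c k = <y, h k>], pairing [y] with
    its synthesis gives back [sqsum c n]. *)
Lemma synth_le_bessel B h : 0 < B ->
  (forall c n, rnorm (synth c h n) ^+ 2 <= B * sqsum c n) -> bessel B h.
Proof.
move=> B0 hB y n; set c := fun k => dot y (h k).
have cE : complex.Re (dot y (synth c h n)) = sqsum c n.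
  rewrite dotC dot_synth -[RHS]/(complex.Re (sqsum c n)%:C); congr complex.Re.
  rewrite [LHS]rmorph_sum [RHS]rmorph_sum; apply: eq_bigr => k _.
  by rewrite (dotC (h k)) -/(c k) -sqmodE; exact: conjc_real.
(* With [s = sqsum c n]: [2 B s <= B^2 |y|^2 + B s], hence [s <= B |y|^2]. *)
have := Re_dot_le B y (synth c h n); rewrite cE => le1.
have le2 := hB c n; rewrite -(ler_pM2l B0); lra.
Qed.

(** * Orthonormal expansions and the Riesz basis criterion *)

Definition complete_seq e : Prop := forall x, (forall k, dot x (e k) = 0) -> x = 0.

Definition biorthogonal f g : Prop := forall j k, dot (f j) (g k) = (j == k)%:R.

Lemma biorthogonalC f g : biorthogonal f g -> biorthogonal g f.
Proof. by move=> fg j k; rewrite dotC fg conjC_nat eq_sym. Qed.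

Lemma orthonormal_bessel e : biorthogonal e e -> bessel 1 e.
Proof.
move=> ee; apply: synth_le_bessel => // c n; rewrite mul1r.
suff -> : rnorm (synth c e n) ^+ 2 = sqsum c n by [].
apply: complexI; rewrite -dotxx dot_synth [RHS]rmorph_sum.
rewrite big_nat [RHS]big_nat; apply: eq_bigr => k /andP[_ kn].
rewrite dotC (dot_synth_biorth c n (fun j => ee j k)) kn.
exact/esym/sqmodE.
Qed.

Lemma bessel_l2 B f x : bessel B f -> l2 (fun k => dot x (f k)).
Proof. by move=> fB; apply/l2P; exists (B * rnorm x ^+ 2) => n; exact: fB. Qed.

(** The series converges by Bessel's inequality; its sum has the same coefficients as [x], so
    completeness identifies the two. *)
Lemma orthonormal_expansion e x : biorthogonal e e -> complete_seq e ->
  synth (fun k => dot x (e k)) e @ \oo --> x.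
Proof.
move=> ee ce; have eB := orthonormal_bessel ee.
have /cvg_ex[y ey] := synth_cvg ltr01 eB (bessel_l2 x eB).
suff yx : y = x by rewrite yx in ey.
apply/eqP; rewrite -subr_eq0; apply/eqP/ce => k.
by rewrite dotBl (biorth_coef (fun j => ee j k) ey) subrr.
Qed.

Lemma complete_orthonormal_basis e : biorthogonal e e -> complete_seq e ->
  orthonormal_basis dot e.
Proof.
move=> ee ce; split=> // x; exists (fun k => dot x (e k)); split.
  exact: orthonormal_expansion.
by move=> c cx; apply/funext => k; exact: (biorth_coef (fun j => ee j k) cx).
Qed.

Lemma synth_lin a c d f n :
  synth (fun k => a * c k + d k) f n = a *: synth c f n + synth d f n.
Proof.
rewrite /synth /series /= scaler_sumr -big_split; apply: eq_bigr => k _ /=.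
by rewrite scalerDl scalerA.
Qed.

Lemma synth_delta f (j : nat) : synth (fun k => (j == k)%:R) f @ \oo --> f j.
Proof.
have sE n : synth (fun k => (j == k)%:R) f n = if (j < n)%N then f j else 0.
  elim: n => [|n IH]; first by rewrite /synth /series /= big_geq.
  move: IH; rewrite /synth /series /= big_nat_recr //= ltnS => ->.
  have [jn|nj|->] := ltngtP j n.
  - by rewrite scale0r addr0.
  - by rewrite scale0r addr0.
  - by rewrite scale1r add0r.
by apply: cvg_near_cst; exists j.+1 => // n /= jn; rewrite sE jn.
Qed.

Lemma synth_cvg_unique c f x y : synth c f @ \oo --> x -> synth c f @ \oo --> y -> x = y.
Proof. by apply: cvg_unique; exact: norm_hausdorff. Qed.

(** The operator is [T_f] after the coefficient map of [e], a bijection from [H] to [l2], so it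
    inherits bijectivity from [T_f]. *)
Lemma synth_bij_riesz_basis B f e : 0 < B -> bessel B f ->
  biorthogonal e e -> complete_seq e ->
  (forall x, exists2 c, l2 c & synth c f @ \oo --> x) ->
  (forall c, l2 c -> synth c f @ \oo --> (0 : H) -> forall k, c k = 0) ->
  riesz_basis dot f.
Proof.
move=> B0 fB ee ce fsurj finj; have eB := orthonormal_bessel ee.
pose a x k := dot x (e k); have a2 x : l2 (a x) := bessel_l2 x eB.
pose T x := limn (synth (a x) f).
have Tx x : synth (a x) f @ \oo --> T x := synth_cvg B0 fB (a2 x).
have Tlin : linear T.
  move=> t x y; apply: synth_cvg_unique (Tx _) _.
  have -> : synth (a (t *: x + y)) f = fun n => t *: synth (a x) f n + synth (a y) f n.
    apply/funext => n; rewrite -synth_lin; congr (synth _ f n); apply/funext => k.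
    by rewrite /a dotDl dotZl.
  by apply: cvgD (Tx y); apply: cvgZr; exact: Tx.
pose U : {linear H -> H} := HB.pack T (GRing.isLinear.Build _ _ _ _ T Tlin).
have Uinj : injective U.
  apply: raddf_inj => x /= x0; apply: ce; apply: finj (a2 x) _.
  by rewrite -x0; exact: Tx.
(* If [c] synthesizes [y] over [f], the preimage is the sum of [c] over [e], whose coefficients are
   [c]. *)
have /choice[V TV] : forall y, exists x, T x = y.
    move=> y; have [c c2 cy] := fsurj y.
    have /cvg_ex[x ex] := synth_cvg ltr01 eB c2.
    exists x; apply: synth_cvg_unique (Tx x) _.
    suff -> : a x = c by [].
    by apply/funext => k; exact: (biorth_coef (fun j => ee j k) ex).
exists e, U; split; first exact: complete_orthonormal_basis.
split; last split.
- exists (Num.sqrt B) => x.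
  rewrite -(@ler_pXn2r _ 2) ?nnegrE ?mulr_ge0 ?rnorm_ge0 ?sqrtr_ge0 //.
  rewrite exprMn sqr_sqrtr ?(ltW B0) //; apply: (synth_lim_le B0 fB (Tx x)) => n.
  by have := eB x n; rewrite mul1r.
- by exists V => // x; apply: Uinj; exact: TV.
- move=> k; apply: synth_cvg_unique (@synth_delta f k) _.
  suff <- : a (e k) = fun j => (k == j)%:R by exact: Tx.
  by apply/funext => j; exact: ee.
Qed.

(** * Heads and tails of coefficient sequences *)

Lemma sqsum_head c n m :
  sqsum (fun k => if (k < n)%N then c k else 0) m = sqsum c (minn m n).
Proof.
elim: m => [|m IH]; first by rewrite min0n /sqsum !big_geq.
rewrite sqsumS IH; have [mn|nm] := ltnP m n.
  by rewrite (minn_idPl mn) sqsumS.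
by rewrite (minn_idPr (leqW nm)) sqmod0 addr0.
Qed.

Lemma sqsum_tail c n m :
  sqsum (fun k => if (k < n)%N then 0 else c k) m = sqsum c m - sqsum c (minn m n).
Proof.
elim: m => [|m IH]; first by rewrite min0n subrr /sqsum big_geq.
rewrite !sqsumS IH; have [mn|nm] := ltnP m n.
  by rewrite (minn_idPl mn) sqsumS sqmod0 !subrr addr0.
by rewrite (minn_idPr (leqW nm)) addrAC.
Qed.

(** * Gram-Schmidt orthonormalization *)

Definition normalize x : H := ((rnorm x)^-1)%:C *: x.

(** Each step subtracts projections on all earlier vectors, so the recursion carries the whole list
    of them. *)
Fixpoint gs_prefix g n : seq H :=
  if n is m.+1 then
    let s := gs_prefix g m in
    rcons s (normalize (g m - \sum_(e <- s) dot (g m) e *: e))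
  else [::].

Definition gs g n : H := nth 0 (gs_prefix g n.+1) n.

Definition gs_residual g n : H := g n - synth (fun k => dot (g n) (gs g k)) (gs g) n.

Lemma size_gs_prefix g n : size (gs_prefix g n) = n.
Proof. by elim: n => //= n IH; rewrite size_rcons IH. Qed.

Lemma nth_gs_prefix g n k : (k < n)%N -> nth 0 (gs_prefix g n) k = gs g k.
Proof.
elim: n => // n IH; rewrite ltnS leq_eqVlt => /orP[/eqP->//|kn].
by rewrite /= nth_rcons size_gs_prefix kn IH.
Qed.

Lemma gsE g n : gs g n = normalize (gs_residual g n).
Proof.
rewrite /gs /= nth_rcons size_gs_prefix ltnn eqxx; congr (normalize (_ - _)).
rewrite (big_nth 0) size_gs_prefix big_nat [RHS]big_nat.
by apply: eq_bigr => k /andP[_ kn]; rewrite nth_gs_prefix.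
Qed.

Lemma dot_gs_residual g n y : dot (gs_residual g n) y =
  dot (g n) y - \sum_(0 <= k < n) dot (g n) (gs g k) * dot (gs g k) y.
Proof. by rewrite dotBl dot_synth. Qed.

Lemma gram_schmidt g h : biorthogonal g h -> complete_seq g ->
  exists2 e, biorthogonal e e & complete_seq e.
Proof.
move=> gh cg; exists (gs g).
  (* [gs g n] is a combination of [g 0, ..., g n], all orthogonal to [h k] for [k > n]. *)
  have gs_h n k : (n < k)%N -> dot (gs g n) (h k) = 0.
    elim/ltn_ind: n k => n IH k nk.
    rewrite gsE dotZl dot_gs_residual gh (ltn_eqF nk) big_nat big1 ?subrr ?mulr0 //.
    by move=> i /andP[_ i_n]; rewrite IH ?mulr0 // (ltn_trans i_n).
  have res0 n : gs_residual g n != 0.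
    apply/eqP => r0; have := dot_gs_residual g n (h n).
    rewrite r0 dot0l gh eqxx big_nat big1 ?subr0 => [/eqP|i /andP[_ i_n]].
      by rewrite eq_sym oner_eq0.
    by rewrite gs_h ?mulr0.
  (* A common bound [n] on both indices makes induction possible: only pairs involving the newest
     vector are new. *)
  suff ee n j k : (j < n)%N -> (k < n)%N -> dot (gs g j) (gs g k) = (j == k)%:R.
    by move=> j k; apply: (ee (maxn j k).+1); rewrite ltnS ?leq_maxl ?leq_maxr.
  elim: n j k => // n IH.
  have gs_n k : (k < n)%N -> dot (gs g n) (gs g k) = 0.
    move=> kn; rewrite gsE dotZl dot_gs_residual.
    have -> : \sum_(0 <= i < n) dot (g n) (gs g i) * dot (gs g i) (gs g k) =
              \sum_(0 <= i < n) dot (g n) (gs g i) * (i == k)%:R.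
      by rewrite big_nat [RHS]big_nat; apply: eq_bigr => i /andP[_ i_n]; rewrite IH.
    by rewrite (sum_delta (fun i => dot (g n) (gs g i))) kn subrr mulr0.
  move=> j k; rewrite !ltnS leq_eqVlt => /orP[/eqP->|jn];
    rewrite leq_eqVlt => /orP[/eqP->|kn].
  - rewrite eqxx gsE dotxx rnormZ_sqr sqmod_real exprVn mulVf //.
    by rewrite -(inj_eq (@complexI R)) -dotxx dnorm_eq0.
  - by rewrite gs_n // gtn_eqF.
  - by rewrite dotC gs_n // conjC0 ltn_eqF.
  - exact: IH.
(* Given [x] orthogonal to every [gs g k], the projections drop out and [<g n, x>] equals
   [<r_n, x>], which vanishes because [r_n] is zero or a nonzero multiple of [gs g n]. *)
move=> x xe; apply: cg => n; have ex k : dot (gs g k) x = 0 by rewrite dotC xe conjC0.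
have := dot_gs_residual g n x; rewrite big1 => [|k _]; last by rewrite ex mulr0.
rewrite subr0 [RHS]dotC => rE; apply: (can_inj conjCK); rewrite -rE conjC0.
have [->|r0] := eqVneq (gs_residual g n) 0; first exact: dot0l.
have := ex n; rewrite gsE dotZl => /eqP; rewrite mulf_eq0 => /orP[|/eqP//].
rewrite -[X in X == _]/(real_complex R _) fmorph_eq0 invr_eq0 => /eqP/rnorm_eq0/eqP.
by rewrite (negPf r0).
Qed.

(** * Frame bounds and the dual system *)

(** Quantifying over bounds [M] of the partial sums expresses the lower inequality without extended
    reals. *)
Lemma frame_bounds f : frame dot f -> exists A B : R, [/\ 0 < A, 0 < B, bessel B f &
  forall x (M : R), (forall n, sqsum (fun k => dot x (f k)) n <= M) ->
    A * rnorm x ^+ 2 <= M].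
Proof.
move=> [A [B [A0 [B0 fAB]]]]; exists A, B; split=> // [x|x M xM].
  by apply/sum_sqr_norm_leP; exact: (fAB x).2.
by rewrite -lee_fin (le_trans (fAB x).1) //; apply/sum_sqr_norm_leP.
Qed.

Section LowerBound.
Variables (A : R) (g : nat -> H).
Hypotheses (A0 : 0 < A) (lower : forall x (M : R),
  (forall n, sqsum (fun k => dot x (g k)) n <= M) -> A * rnorm x ^+ 2 <= M).

Lemma lower_complete : complete_seq g.
Proof.
move=> x x0; have : A * rnorm x ^+ 2 <= 0.
  by apply: lower => n; rewrite /sqsum big1 // => k _; rewrite x0 sqmod0.
rewrite pmulr_rle0 // => x2; apply: rnorm_eq0; apply/eqP.
by rewrite -sqrf_eq0 eq_le x2 sqr_ge0.
Qed.

(** The [g]-coefficients of a partial sum over [h] are a truncation of [c], so the lower bound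
    controls its norm. *)
Lemma dual_bessel h : biorthogonal h g -> bessel A^-1 h.
Proof.
move=> hg; apply: synth_le_bessel => [|c n]; first by rewrite invr_gt0.
rewrite mulrC ler_pdivlMr // mulrC; apply: lower => m.
have -> : (fun k => dot (synth c h n) (g k)) = fun k => if (k < n)%N then c k else 0.
  by apply/funext => k; rewrite (dot_synth_biorth c n (fun j => hg j k)).
by rewrite sqsum_head sqsum_homo // geq_minr.
Qed.

(* If [x] is orthogonal to [h], then [x] is orthogonal to each partial sum [s] of
   its dual expansion, so [|x| <= |x - s|], whereas the coefficients of [x - s]
   are a tail of those of [x]. *)
Lemma dual_complete B h : bessel B g -> biorthogonal h g -> complete_seq h.
Proof.
move=> gB hg x xh; pose c k := dot x (g k).
suff : A * rnorm x ^+ 2 <= 0.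
  rewrite pmulr_rle0 // => x2; apply: rnorm_eq0; apply/eqP.
  by rewrite -sqrf_eq0 eq_le x2 sqr_ge0.
apply/ler_addgt0Pr => e e0; rewrite add0r.
have [N cN] := l2_tail (bessel_l2 x gB) e0.
have xs : dot x (synth c h N) = 0.
  rewrite dotC dot_synth big1 ?conjC0 // => k _.
  by rewrite [dot (h k) x]dotC xh conjC0 mulr0.
apply: (@le_trans _ _ (A * rnorm (x - synth c h N) ^+ 2)).
  by rewrite ler_pM2l // rnormB_sqr xs /= mulr0 subr0 lerDl sqr_ge0.
apply: lower => m.
have -> : (fun k => dot (x - synth c h N) (g k)) =
    fun k => if (k < N)%N then 0 else c k.
  apply/funext => k; rewrite dotBl (dot_synth_biorth c N (fun j => hg j k)).
  by case: ifP; rewrite ?subrr ?subr0.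
rewrite sqsum_tail; have [mN|Nm] := leqP m N; first by rewrite subrr ltW.
by apply/ltW/cN; rewrite leqnn ltnW.
Qed.

End LowerBound.

(** * Factoring the cross-Gram operator *)

Lemma frame_riesz_basis f g : frame dot f -> frame dot g ->
  set_bij (@l2 R) (@l2 R) (mx_op (cross_gram dot f g)) ->
  riesz_basis dot f /\ riesz_basis dot g.
Proof.
move=> ff fg [_ Ginj Gsurj].
have [A1 [B1 [_ B10 fB _]]] := frame_bounds ff.
have [A [B [A0 B0 gB lower]]] := frame_bounds fg.
(* This is the factorization [G = C_g T_f], by continuity of the inner product. *)
have GE c x : synth c f @ \oo --> x ->
    mx_op (cross_gram dot f g) c = fun j => dot x (g j).
  move=> cx; apply/funext => j; apply: (@cvg_lim R[i]^o); first exact: norm_hausdorff.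
  suff -> : mx_row_series (cross_gram dot f g) c j = fun n => dot (synth c f n) (g j).
    exact: dot_cvg.
  by apply/funext => n; rewrite dot_synth.
have coef_surj d : l2 d -> exists x c,
    [/\ l2 c, synth c f @ \oo --> x & forall j, dot x (g j) = d j].
  move=> /Gsurj[c c2 cd]; have /cvg_ex[x cx] := synth_cvg B10 fB c2.
  by exists x, c; split=> // j; rewrite -cd (GE c x cx).
have cg := lower_complete A0 lower.
have delta2 (j : nat) : l2 (fun k => (j == k)%:R : R[i]).
  (* Writing the delta sequence as its own truncation at [j.+1] makes [sqsum_head] bound its partial
     sums. *)
  have -> : (fun k => (j == k)%:R) =
      fun k => if (k < j.+1)%N then (j == k)%:R else 0 : R[i].
    by apply/funext => k; case: ltnP => // jk; rewrite ltn_eqF.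
  apply/l2P; exists (sqsum (fun k => (j == k)%:R) j.+1) => n.
  by rewrite sqsum_head sqsum_homo // geq_minr.
have [h hg] : exists h, biorthogonal h g.
  have /choice[h hg] : forall j : nat, exists x, forall k, dot x (g k) = (j == k)%:R.
    by move=> j; have [x [c [_ _ xj]]] := coef_surj _ (delta2 j); exists x.
  by exists h.
have gh := biorthogonalC hg.
have hB := dual_bessel A0 lower hg.
have ch := dual_complete A0 lower gB hg.
have [e ee ce] := gram_schmidt gh cg.
split.
- apply: (synth_bij_riesz_basis B10 fB ee ce) => [x|c c2 c0 k].
    (* Some [y] in the range of [T_f] has the same [g]-coefficients as [x]; completeness of [g]
       gives [y = x]. *)
    have [y [c [c2 cy yx]]] := coef_surj _ (bessel_l2 x gB).
    exists c => //; suff <- : y = x by [].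
    apply/eqP; rewrite -subr_eq0; apply/eqP/cg => k.
    by rewrite dotBl yx subrr.
  have z2 : l2 (fun _ => 0 : R[i]).
    by apply/l2P; exists 0 => n; rewrite /sqsum big1 // => i _; rewrite sqmod0.
  suff -> : c = fun=> 0 by [].
  (* Both [c] and the zero sequence synthesize 0, so [G] agrees on them. *)
  apply: Ginj; rewrite ?inE // (GE c 0 c0) (GE (fun=> 0) 0) //.
  apply: cvg_near_cst; exists 0%N => // n _.
  by rewrite /synth /series /= big1 // => i _; rewrite scale0r.
- apply: (synth_bij_riesz_basis B0 gB ee ce) => [x|c c2 c0 k].
    (* The coefficients sought are [<x, h k>]: their synthesis over [g] has the [h]-coefficients of
       [x], and [h] is complete. *)
    have c2 := bessel_l2 x hB.
    have /cvg_ex[y cy] := synth_cvg B0 gB c2; exists (fun k => dot x (h k)) => //.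
    suff yx : y = x by rewrite yx in cy.
    apply/eqP; rewrite -subr_eq0; apply/eqP/ch => k.
    by rewrite dotBl (biorth_coef (fun j => gh j k) cy) subrr.
  by rewrite -(biorth_coef (fun j => gh j k) c0) dot0l.
Qed.

End Synthesis.

Theorem theorem2p8 (R : realType) (H : completeNormedModType R[i])
    (dot : {dot H for Num.conj})
    (normE : forall x : H, dot x x = `|x| ^+ 2)
    (f g : nat -> H)
    (frame_f : frame dot f) (frame_g : frame dot g)
    (bounded_G : l2_bounded_mx (cross_gram dot f g))
    (invertible_G : l2_invertible (mx_op (cross_gram dot f g))) :
  riesz_basis dot f /\ riesz_basis dot g.
Proof. by case: invertible_G => bij_G _; exact: frame_riesz_basis. Qed.
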